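(* $\mathsf{iA}_{\mathsf{fp}}+\mathsf S_\Box$ proves the strong Löb principle: for every formula $\phi$ of the language of $\mathsf{iA}_{\mathsf{fp}}$, $$\mathsf{iA}_{\mathsf{fp}}+\mathsf S_\Box\vdash(\Box\phi\to\phi)\to\phi .$$
   Context: The language of $\mathsf{iA}_{\mathsf{fp}}$ has an operator $\digamma$ forming primitive guarded fixed points and a designated variable $\ast$ bound by $\digamma$. Its formulas are the expressions $\phi$ given by the simultaneous grammar - $\pi::=p_0\mid p_1\mid p_2\mid\dots$, - $\phi::=\pi\mid\top\mid\bot\mid\digamma\chi\mid(\phi\wedge\phi)\mid(\phi\vee\phi)\mid(\phi\to\phi)\mid(\phi\rightsquigarrow\phi)$, - $\psi::=\ast\mid\pi\mid\top\mid\bot\mid\digamma\chi\mid(\psi\wedge\psi)\mid(\psi\vee\psi)\mid(\psi\to\psi)\mid(\psi\rightsquigarrow\psi)$, - $\chi::=\pi\mid\top\mid\bot\mid\digamma\chi\mid(\chi\wedge\chi)\mid(\chi\vee\chi)\mid(\chi\to\chi)\mid(\psi\rightsquigarrow\psi)$. An occurrence of $\ast$ is bound by the lowest $\digamma$ above it in the parse tree. For a $\chi$-expression $\chi$ and a formula $\phi$, $\chi\phi$ denotes the result of replacing in $\chi$ all free occurrences of $\ast$ (those not in the scope of a $\digamma$ inside $\chi$) by $\phi$. Abbreviations: $\Box\phi:=(\top\rightsquigarrow\phi)$, and $\leftrightarrow$ is defined as usual. The system $\mathsf{iA}_{\mathsf{fp}}$ has, for formulas $\phi,\psi,\chi$ of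 this extended language: all axioms and rules of intuitionistic propositional logic; the rule: from $\vdash\phi\to\psi$ infer $\vdash\phi\rightsquigarrow\psi$; the axiom schemes $((\phi\rightsquigarrow\psi)\wedge(\psi\rightsquigarrow\chi))\to(\phi\rightsquigarrow\chi)$, $((\phi\rightsquigarrow\psi)\wedge(\phi\rightsquigarrow\chi))\to(\phi\rightsquigarrow(\psi\wedge\chi))$, $((\phi\rightsquigarrow\chi)\wedge(\psi\rightsquigarrow\chi))\to((\phi\vee\psi)\rightsquigarrow\chi)$; and the fixed point axioms $\digamma\chi\leftrightarrow\chi(\digamma\chi)$ for all $\chi$-expressions $\chi$. $\mathsf{iA}_{\mathsf{fp}}+\mathsf S_\Box$ adds the axiom scheme $\phi\to\Box\phi$ for all formulas $\phi$ of the extended language (all rules applying to the extended system). *)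

(* Defs.v *)
(** Raw expressions, over which the three syntactic classes of the grammar
    are carved out below: the classes overlap as sets of expressions, and
    [formula e -> chi_expr e -> psi_expr e]. *)
Inductive expr : Type :=
| Star : expr
| Var : nat -> expr
| Top : expr
| Bot : expr
| Fix : expr -> expr
| And : expr -> expr -> expr
| Or : expr -> expr -> expr
| Imp : expr -> expr -> expr
| Arrow : expr -> expr -> expr.

Declare Scope iA_scope.
Delimit Scope iA_scope with iA.
Bind Scope iA_scope with expr.

Notation "⊤" := Top : iA_scope.
Notation "⊥" := Bot : iA_scope.
Notation "A ⇝ B" := (Arrow A B)
  (at level 58, no associativity) : iA_scope.
Notation "A ∧ B" := (And A B)
  (at level 60, right associativity) : iA_scope.
Notation "A ∨ B" := (Or A B)
  (at level 62, right associativity) : iA_scope.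
Notation "A → B" := (Imp A B)
  (at level 64, right associativity) : iA_scope.

Definition Iff (A B : expr) : expr := ((A → B) ∧ (B → A))%iA.
Definition Box (A : expr) : expr := (⊤ ⇝ A)%iA.

Notation "A ↔ B" := (Iff A B)
  (at level 66, no associativity) : iA_scope.
Notation "□ A" := (Box A)
  (at level 56, right associativity) : iA_scope.

Local Open Scope iA_scope.

(** [formula], [psi_expr] and [chi_expr] are the classes phi, psi and chi:
    no free star, arbitrary free stars, and free stars only below an arrow. *)
Inductive formula : expr -> Prop :=
| formula_Var n : formula (Var n)
| formula_Top : formula ⊤
| formula_Bot : formula ⊥
| formula_Fix X : chi_expr X -> formula (Fix X)
| formula_And A B : formula A -> formula B -> formula (A ∧ B)
| formula_Or A B : formula A -> formula B -> formula (A ∨ B)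
| formula_Imp A B : formula A -> formula B -> formula (A → B)
| formula_Arrow A B : formula A -> formula B -> formula (A ⇝ B)
with psi_expr : expr -> Prop :=
| psi_Star : psi_expr Star
| psi_Var n : psi_expr (Var n)
| psi_Top : psi_expr ⊤
| psi_Bot : psi_expr ⊥
| psi_Fix X : chi_expr X -> psi_expr (Fix X)
| psi_And A B : psi_expr A -> psi_expr B -> psi_expr (A ∧ B)
| psi_Or A B : psi_expr A -> psi_expr B -> psi_expr (A ∨ B)
| psi_Imp A B : psi_expr A -> psi_expr B -> psi_expr (A → B)
| psi_Arrow A B : psi_expr A -> psi_expr B -> psi_expr (A ⇝ B)
with chi_expr : expr -> Prop :=
| chi_Var n : chi_expr (Var n)
| chi_Top : chi_expr ⊤
| chi_Bot : chi_expr ⊥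
| chi_Fix X : chi_expr X -> chi_expr (Fix X)
| chi_And A B : chi_expr A -> chi_expr B -> chi_expr (A ∧ B)
| chi_Or A B : chi_expr A -> chi_expr B -> chi_expr (A ∨ B)
| chi_Imp A B : chi_expr A -> chi_expr B -> chi_expr (A → B)
| chi_Arrow A B : psi_expr A -> psi_expr B -> chi_expr (A ⇝ B).

(** [subst C X] is [X] with its free stars replaced by [C]. Stars below a
    [Fix] are bound, so the recursion stops there; no capture can occur when
    [C] is a formula. *)
Fixpoint subst (C X : expr) : expr :=
  match X with
  | Star => C
  | Var n => Var n
  | Top => ⊤
  | Bot => ⊥
  | Fix Y => Fix Y
  | And A B => subst C A ∧ subst C B
  | Or A B => subst C A ∨ subst C B
  | Imp A B => subst C A → subst C B
  | Arrow A B => subst C A ⇝ subst C B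
  end.

(** [iAfp Ax A]: the formula [A] is a theorem of iA_fp extended with the
    formulas in [Ax] as further axioms. All axioms are required to be
    formulas, hence so are all theorems. *)
Inductive iAfp (Ax : expr -> Prop) : expr -> Prop :=
| iAfp_extra A : formula A -> Ax A -> iAfp Ax A
| iAfp_K A B : formula A -> formula B -> iAfp Ax (A → B → A)
| iAfp_S A B C : formula A -> formula B -> formula C ->
    iAfp Ax ((A → B → C) → (A → B) → A → C)
| iAfp_andI A B : formula A -> formula B -> iAfp Ax (A → B → A ∧ B)
| iAfp_andE1 A B : formula A -> formula B -> iAfp Ax (A ∧ B → A)
| iAfp_andE2 A B : formula A -> formula B -> iAfp Ax (A ∧ B → B)
| iAfp_orI1 A B : formula A -> formula B -> iAfp Ax (A → A ∨ B)
| iAfp_orI2 A B : formula A -> formula B -> iAfp Ax (B → A ∨ B)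
| iAfp_orE A B C : formula A -> formula B -> formula C ->
    iAfp Ax ((A → C) → (B → C) → A ∨ B → C)
| iAfp_top : iAfp Ax ⊤
| iAfp_bot A : formula A -> iAfp Ax (⊥ → A)
| iAfp_mp A B : iAfp Ax (A → B) -> iAfp Ax A -> iAfp Ax B
| iAfp_nec A B : iAfp Ax (A → B) -> iAfp Ax (A ⇝ B)
| iAfp_trans A B C : formula A -> formula B -> formula C ->
    iAfp Ax ((A ⇝ B) ∧ (B ⇝ C) → (A ⇝ C))
| iAfp_conj A B C : formula A -> formula B -> formula C ->
    iAfp Ax ((A ⇝ B) ∧ (A ⇝ C) → (A ⇝ (B ∧ C)))
| iAfp_disj A B C : formula A -> formula B -> formula C ->
    iAfp Ax ((A ⇝ C) ∧ (B ⇝ C) → ((A ∨ B) ⇝ C))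
| iAfp_fix X : chi_expr X -> iAfp Ax (Fix X ↔ subst (Fix X) X).

Inductive S_Box : expr -> Prop :=
| S_Box_intro A : formula A -> S_Box (A → □ A).

(* Main.v *)
Require Import Defs.

(** Let [F := Fix (□ Star → A)], so that [F ↔ (□ F → A)] is provable: this is
    Löb's classical sentence. Since [F → □ F] is an instance of the scheme
    [S_Box], the antecedent [□ F] is free once [F] holds, and [F → A] is
    outright a theorem ([loeb_sentence_imp]). Hence [□ F → □ A] is a theorem as
    well, by monotonicity of the box. Now argue from the hypothesis [□ A → A]:
    it gives [□ F → A], which is [F] by the fixed point equation, and [F]
    yields [A].

    The box is applied to theorems only, never to the hypothesis [□ A → A];
    this is why the conclusion comes out as an implication, the strong Löb
    principle, rather than as a rule. *)

Local Open Scope iA_scope.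

Local Hint Constructors formula psi_expr chi_expr : iA.

Lemma formula_psi_expr A : formula A -> psi_expr A.
Proof. induction 1; auto with iA. Qed.

Lemma formula_chi_expr A : formula A -> chi_expr A.
Proof. induction 1; auto using formula_psi_expr with iA. Qed.

Lemma subst_formula C A : formula A -> subst C A = A.
Proof. induction 1; simpl; congruence. Qed.

Lemma formula_Box A : formula A -> formula (□ A).
Proof. unfold Box; auto with iA. Qed.

Local Hint Resolve formula_Box : iA.

Section Derivations.

Variable Ax : expr -> Prop.

Lemma iAfp_weaken A B :
  formula A -> formula B -> iAfp Ax B -> iAfp Ax (A → B).
Proof.
intros HA HB H; apply (iAfp_mp _ B); [apply iAfp_K|]; assumption.
Qed.

Lemma iAfp_mp_under A B C : formula A -> formula B -> formula C ->
  iAfp Ax (A → B → C) -> iAfp Ax (A → B) -> iAfp Ax (A → C).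
Proof.
intros HA HB HC H1 H2; apply (iAfp_mp _ (A → B)); [|assumption].
apply (iAfp_mp _ (A → B → C)); [apply iAfp_S|]; assumption.
Qed.

Lemma iAfp_imp_trans A B C : formula A -> formula B -> formula C ->
  iAfp Ax (A → B) -> iAfp Ax (B → C) -> iAfp Ax (A → C).
Proof.
intros HA HB HC H1 H2; apply (iAfp_mp_under A B C); auto.
apply iAfp_weaken; auto with iA.
Qed.

Lemma iAfp_precomp A B C : formula A -> formula B -> formula C ->
  iAfp Ax (A → B) -> iAfp Ax ((B → C) → A → C).
Proof.
intros HA HB HC H.
apply (iAfp_mp_under _ (A → B)); auto with iA.
- apply (iAfp_imp_trans _ (A → B → C)); auto with iA.
  + apply iAfp_K; auto with iA.
  + apply iAfp_S; auto.
- apply iAfp_weaken; auto with iA.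
Qed.

Lemma iAfp_iffE A B : formula A -> formula B ->
  iAfp Ax (A ↔ B) -> iAfp Ax (A → B) /\ iAfp Ax (B → A).
Proof.
intros HA HB H; split; apply (iAfp_mp _ (A ↔ B)); trivial.
- apply iAfp_andE1; auto with iA.
- apply iAfp_andE2; auto with iA.
Qed.

Lemma iAfp_Box_mono A B : formula A -> formula B ->
  iAfp Ax (A → B) -> iAfp Ax (□ A → □ B).
Proof.
intros HA HB H.
apply (iAfp_imp_trans _ ((⊤ ⇝ A) ∧ (A ⇝ B))); auto with iA.
- apply (iAfp_mp_under _ (A ⇝ B)); auto with iA.
  + apply iAfp_andI; auto with iA.
  + apply iAfp_weaken; auto with iA; apply iAfp_nec; assumption.
- apply iAfp_trans; auto with iA.
Qed.

End Derivations.

Definition loeb_sentence (A : expr) : expr := Fix (□ Star → A).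

(** The star is guarded because the box is an arrow, whose arguments may
    contain arbitrary stars. *)
Lemma loeb_sentence_chi A : formula A -> chi_expr (□ Star → A).
Proof. unfold Box; auto using formula_chi_expr with iA. Qed.

Lemma formula_loeb_sentence A : formula A -> formula (loeb_sentence A).
Proof. intros HA; apply formula_Fix, loeb_sentence_chi; exact HA. Qed.

Local Hint Resolve formula_loeb_sentence : iA.

Lemma loeb_sentence_fix Ax A : formula A ->
  iAfp Ax (loeb_sentence A → □ loeb_sentence A → A) /\
  iAfp Ax ((□ loeb_sentence A → A) → loeb_sentence A).
Proof.
intros HA; apply iAfp_iffE; auto with iA.
generalize (iAfp_fix Ax _ (loeb_sentence_chi A HA)).
(* [A] has no free star, so unfolding the fixed point leaves it unchanged. *)
simpl; rewrite subst_formula; trivial.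
Qed.

(** The premise [□ F] that the Löb sentence [F] asks for is supplied by [F]
    itself, through the completeness axiom [F → □ F]. *)
Lemma loeb_sentence_imp A : formula A -> iAfp S_Box (loeb_sentence A → A).
Proof.
intros HA; apply (iAfp_mp_under _ _ (□ loeb_sentence A)); auto with iA.
- apply loeb_sentence_fix; exact HA.
- apply iAfp_extra; [|apply S_Box_intro]; auto with iA.
Qed.

Theorem theorem3p16 (A : expr) (HA : formula A) :
  iAfp S_Box ((□ A → A) → A)%iA.
Proof.
apply (iAfp_imp_trans _ _ (□ loeb_sentence A → A)); auto with iA.
- apply iAfp_precomp; auto with iA.
  apply iAfp_Box_mono; auto using loeb_sentence_imp with iA.
- apply (iAfp_imp_trans _ _ (loeb_sentence A)); auto with iA.
  + apply loeb_sentence_fix; exact HA.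
  + apply loeb_sentence_imp; exact HA.
Qed.
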